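(* Let $G=(V,E)$ be a complete undirected graph whose vertices are points of the Euclidean plane, let $m=|E|$, and let $\mathcal{F}_{xy}\subseteq\mathbb{R}^m\times\mathbb{R}^{2m}$ be the polyhedron defined in the context for an angle $\alpha\in(0,2\pi]$. If $\alpha\ge\pi$ and $(\overline{\mathbf{x}},\overline{\mathbf{y}})\in\mathcal{F}_{xy}$ with $\overline{\mathbf{x}}\in\{0,1\}^m$, then there exists $\hat{\mathbf{y}}\in\{0,1\}^{2m}$ such that $(\overline{\mathbf{x}},\hat{\mathbf{y}})\in\mathcal{F}_{xy}\cap\{0,1\}^{3m}$.
   Context: $G=(V,E)$ is a complete undirected graph with $n=|V|$ vertices and $m=|E|$ edges; the vertices are pairwise distinct points of the Euclidean plane. For $i\in V$, $\delta(i)$ is the set of edges incident to $i$; for $S\subseteq V$, $E(S)$ is the set of edges with both endpoints in $S$. Angles: for $i\ne j$ in $V$, $\measuredangle_{0ij}\in[0,2\pi)$ is the anti-clockwise angle from the direction $(1,0)$ to the direction of the vector from $i$ to $j$. For $j,k\in V\setminus\{i\}$, $\measuredangle_{jik}=\measuredangle_{0ik}-\measuredangle_{0ij}$ if $\measuredangle_{0ik}\ge\measuredangle_{0ij}$, and $\measuredangle_{jik}=2\pi+\measuredangle_{0ik}-\measuredangle_{0ij}$ otherwise. For $i\neq j$, $L_{ij}=\{j\}\cup\{k\in V\setminus\{i,j\}:\measuredangle_{kij}\le\alpha\}$. $\mathcal{F}_{\mathcal{T}}$ is the set of $\mathbf{x}=(x_e)_{e\in E}\in\mathbb{R}^m$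 with $\sum_{e\in E}x_e=n-1$; $\sum_{e\in E(S)}x_e\le|S|-1$ for all $\emptyset\ne S\subsetneq V$; $x_e\ge0$ for all $e\in E$. $\mathcal{F}_{xy}$ is the set of $(\mathbf{x},\mathbf{y})$, where $\mathbf{y}=(y_{ij})$ is indexed by ordered pairs $(i,j)$ of distinct vertices (so $\mathbf{y}\in\mathbb{R}^{2m}$), such that $\mathbf{x}\in\mathcal{F}_{\mathcal{T}}$; $\sum_{j\in V\setminus\{i\}}y_{ij}=1$ for all $i\in V$; $y_{ij}\le x_e$ for all $i\in V$ and $e=\{i,j\}\in\delta(i)$; $x_e\le\sum_{k\in L_{ij}}y_{ik}$ for all $i\in V$ and $e=\{i,j\}\in\delta(i)$; and $y_{ij}\ge0$ for all $i\ne j$. *)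

(* Defs.v *)
From HB Require Import structures.
From mathcomp Require Import all_boot all_order all_algebra.
From mathcomp Require Import ring lra.
From mathcomp Require Import mathcomp_extra boolp reals trigo.
From mathcomp Require classical_sets.
Set Implicit Arguments.
Unset Strict Implicit.
Unset Printing Implicit Defensive.
Import Order.TTheory GRing.Theory Num.Theory.
Local Open Scope ring_scope.

Notation edge V := {e : {set V} | #|e| == 2%N}.
Notation dart V := {p : V * V | p.1 != p.2}.

Section CompleteGraph.
Variable V : finType.

Definition src (a : dart V) : V := (val a).1.
Definition tgt (a : dart V) : V := (val a).2.

Fact dart_edge_subproof (a : dart V) : #|[set src a; tgt a]| == 2%N.
Proof. by rewrite cards2 (valP a). Qed.

Definition dart_edge (a : dart V) : edge V :=
  exist (fun e : {set V} => #|e| == 2%N) _ (dart_edge_subproof a).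

Definition edges_in (S : {set V}) : {set edge V} :=
  [set e : edge V | val e \subset S].

End CompleteGraph.

Section Angles.
Variable R : realType.
Implicit Types u v : R * R.

Definition polar_angle_of u (t : R) : Prop :=
  0 <= t < 2 * pi /\ exists2 r : R, 0 < r & u = (r * cos t, r * sin t).

(* Well defined for u <> 0 by dir_angleP and polar_angle_of_inj below;
   the value at u = 0 is irrelevant. *)
Definition dir_angle u : R := classical_sets.xget 0 (polar_angle_of u).

Lemma dir_angleP u : u != 0 -> polar_angle_of u (dir_angle u).
Proof.
case: u => a b u0.
suff [t tP] : exists t, polar_angle_of (a, b) t.
  exact: (classical_sets.xgetI (P := polar_angle_of (a, b)) 0 tP).
pose r := Num.sqrt (a ^+ 2 + b ^+ 2).
have s0 : 0 < a ^+ 2 + b ^+ 2.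
  rewrite lt_neqAle addr_ge0 ?sqr_ge0// andbT eq_sym paddr_eq0 ?sqr_ge0//.
  by rewrite !sqrf_eq0; apply: contraNN u0 => /andP[/eqP-> /eqP->].
have r0 : 0 < r by rewrite sqrtr_gt0.
have r2 : r ^+ 2 = a ^+ 2 + b ^+ 2 by rewrite sqr_sqrtr// ltW.
have c1 : -1 <= a / r <= 1.
  rewrite -ler_norml normrM normfV (gtr0_norm r0) ler_pdivrMr// mul1r.
  by rewrite -sqrtr_sqr ler_wsqrtr// lerDl sqr_ge0.
have [/andP[t0 tpi] ct] := acos_def c1.
have st : sin (acos (a / r)) = `|b| / r.
  have -> : `|b| / r = `|b / r| by rewrite normrM normfV (gtr0_norm r0).
  rewrite sin_acos// -sqrtr_sqr; congr (Num.sqrt _); rewrite !exprMn !exprVn.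
  have -> : b ^+ 2 = r ^+ 2 - a ^+ 2 by rewrite r2 addrC addKr.
  by rewrite mulrBl mulfV// expf_neq0// gt_eqF.
have rK x : r * (x / r) = x by rewrite mulrC divfK// gt_eqF.
have pi0 := pi_gt0 R.
case: (leP 0 b) => b0.
  exists (acos (a / r)); split; first by rewrite t0 /=; lra.
  by exists r => //; rewrite ct st ger0_norm// !rK.
have t1 : 0 < acos (a / r).
  rewrite lt_neqAle t0 andbT; apply/eqP => E; move: st.
  rewrite -E sin0 => /esym/eqP; rewrite mulf_eq0 invr_eq0 (gt_eqF r0) orbF.
  by rewrite normr_eq0 lt_eqF.
have E : 2 * pi - acos (a / r) = - acos (a / r) + pi *+ 2.
  by rewrite mulr_natl addrC.
exists (2 * pi - acos (a / r)); split.
  by apply/andP; split; lra.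
exists r => //; rewrite E cosD2pi sinD2pi cosN sinN ct st ltr0_norm//.
by rewrite mulNr opprK !rK.
Qed.

Lemma polar_angle_of_inj u s t :
  polar_angle_of u s -> polar_angle_of u t -> s = t.
Proof.
wlog st : s t / s <= t.
  move=> W; case/orP: (le_total s t) => h hs ht; first exact: W.
  exact/esym/W.
move=> [/andP[s0 s2] [r r0 ->]] [/andP[t0 t2] [q q0 [Ec Es]]].
have rq : r = q.
  have : r ^+ 2 = q ^+ 2.
    rewrite -[r ^+ 2]mulr1 -[q ^+ 2]mulr1 -[in LHS](cos2Dsin2 s).
    by rewrite -(cos2Dsin2 t) !mulrDr -!exprMn Ec Es.
  by move/eqP; rewrite eqrXn2 ?ltW// => /eqP.
have cst : cos (t - s) = 1.
  have r0' : r != 0 by rewrite gt_eqF.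
  rewrite cosB; move: Ec Es; rewrite -rq => /(mulfI r0') -> /(mulfI r0') ->.
  by rewrite -!expr2 cos2Dsin2.
have pi0 := pi_gt0 R.
have [d|d] := leP (t - s) pi.
  have : t - s = 0.
    by apply: cos_inj; rewrite ?cos0// in_itv /= ?lexx ?d ?subr_ge0 ?st ?ltW.
  by move/eqP; rewrite subr_eq0 => /eqP.
have : 2 * pi - (t - s) = 0.
  apply: cos_inj.
  - by rewrite in_itv /=; apply/andP; split; lra.
  - by rewrite in_itv /= lexx ltW.
  - by rewrite addrC mulr_natl cosD2pi cosN cst cos0.
by lra.
Qed.

Variables (V : finType) (pos : V -> R * R).


Definition angle0 (i j : V) : R := dir_angle (pos j - pos i).

(* The anti-clockwise angle at the middle argument i, swept from j to k. *)
Definition angle (j i k : V) : R :=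
  if angle0 i j <= angle0 i k then angle0 i k - angle0 i j
  else 2 * pi + angle0 i k - angle0 i j.

Definition Lset (alpha : R) (i j : V) : {set V} :=
  j |: [set k | [&& k != i, k != j & angle k i j <= alpha]].

End Angles.

Section Polyhedra.
Variables (R : realType) (V : finType).
Implicit Types (x : {ffun edge V -> R}) (y : {ffun dart V -> R}).

(* #|V|%:R - 1 avoids the truncated predecessor of nat when V is empty. *)
Definition F_T x : Prop :=
  [/\ \sum_e x e = #|V|%:R - 1,
      forall S : {set V}, S != set0 -> S \proper [set: V] ->
        \sum_(e in edges_in S) x e <= #|S|%:R - 1
    & forall e, 0 <= x e].

Definition F_xy (pos : V -> R * R) (alpha : R) x y : Prop :=
  [/\ F_T x,
      forall i : V, \sum_(a : dart V | src a == i) y a = 1,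
      forall a : dart V, y a <= x (dart_edge a),
      forall a : dart V, x (dart_edge a) <=
        \sum_(b : dart V | (src b == src a) &&
                          (tgt b \in Lset pos alpha (src a) (tgt a))) y b
    & forall a : dart V, 0 <= y a].

Definition zero_one (I : finType) (v : {ffun I -> R}) : Prop :=
  forall i, v i = 0 \/ v i = 1.

End Polyhedra.

(* Main.v *)
Require Import Defs.
From mathcomp Require Import all_boot all_order all_algebra.
From mathcomp Require Import reals trigo.
Import Order.TTheory GRing.Theory Num.Theory.
Local Open Scope ring_scope.

(** At each vertex i, the values y_ij form a probability distribution on the
    darts leaving i.  When x is integral, an edge {i, j} with x_e = 1 forces this
    distribution to give the whole of its unit mass to L_ij, so every dart of
    positive mass at i ends in L_ij, simultaneously for all such j
    ([mass_concentrated]).  Concentrating the mass at i on any single dart of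
    positive mass therefore keeps all the covering constraints; and that dart
    lies on an edge with 0 < y_ij <= x_e, hence x_e = 1, so the constraints
    y_ij <= x_e survive as well.  Rounding every vertex in this way gives the
    required 0-1 vector. *)

(** An element of positive mass outside Q would leave less than c for Q. *)
Lemma mass_concentrated (R : numDomainType) (I : finType) (P Q : pred I)
    (f : I -> R) (c : R) (b : I) :
  (forall i, 0 <= f i) -> \sum_(i | P i) f i = c ->
  c <= \sum_(i | P i && Q i) f i -> P b -> 0 < f b -> Q b.
Proof.
move=> f_ge0 <- + Pb fb; apply: contraLR => nQb.
rewrite (bigID Q) /= lt_geF// ltrDl (bigD1 b) ?Pb//=.
by rewrite ltr_pwDl// sumr_ge0.
Qed.

Lemma psumr_gt0_exists (R : numDomainType) (I : finType) (P : pred I)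
    (f : I -> R) :
  (forall i, 0 <= f i) -> 0 < \sum_(i | P i) f i -> exists2 i, P i & 0 < f i.
Proof.
move=> f_ge0 sum_gt0.
have /eqP/psumr_neq0P[//|i /andP[Pi fi]] := lt0r_neq0 sum_gt0.
by exists i.
Qed.

Theorem proposition2 (R : realType) (V : finType) (pos : V -> R * R)
    (pos_inj : injective pos) (alpha : R)
    (alpha_gt0 : 0 < alpha) (alpha_le2pi : alpha <= 2 * pi)
    (alpha_gepi : pi <= alpha)
    (xbar : {ffun edge V -> R}) (ybar : {ffun dart V -> R})
    (xybar_in : F_xy pos alpha xbar ybar) (xbar01 : zero_one xbar) :
  exists2 yhat : {ffun dart V -> R}, zero_one yhat &
    F_xy pos alpha xbar yhat /\ (zero_one xbar /\ zero_one yhat).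
Proof.
have [FTx y_sum1 y_le_x x_le_yL y_ge0] := xybar_in.
have /fin_all_exists2 [out src_out y_out] i :
    exists2 b : dart V, src b == i & 0 < ybar b.
  by apply: psumr_gt0_exists => //; rewrite y_sum1.
pose yhat : {ffun dart V -> R} := [ffun a => (a == out (src a))%:R].
have yhat01 : zero_one yhat.
  by move=> a; rewrite ffunE; case: eqP => _; [right | left].
have yhat_ge0 a : 0 <= yhat a by rewrite ffunE ler0n.
have yhat_out i : yhat (out i) = 1 by rewrite ffunE (eqP (src_out i)) eqxx.
exists yhat => //; split=> //; split=> // [i|a|a].
- rewrite (bigD1 (out i)) ?src_out//= yhat_out big1 ?addr0// => b.
  by case/andP=> /eqP src_b /negPf b_out; rewrite ffunE src_b b_out.
- rewrite ffunE; case: eqP => [a_out|_]; last first.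
    exact: le_trans (y_ge0 a) (y_le_x a).
  have : 0 < xbar (dart_edge a).
    by apply: lt_le_trans (y_le_x a); rewrite a_out.
  by case: (xbar01 (dart_edge a)) => ->; rewrite ?ltxx.
- case: (xbar01 (dart_edge a)) => xa; rewrite xa; first exact: sumr_ge0.
  have out_in_L : tgt (out (src a)) \in Lset pos alpha (src a) (tgt a).
    apply: (mass_concentrated _ _ (fun b => src b == src a)
      (fun b => tgt b \in Lset pos alpha (src a) (tgt a))
      ybar 1) => //.
    by rewrite -xa.
  by rewrite (bigD1 (out (src a))) ?src_out//= yhat_out lerDl sumr_ge0.
Qed.
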